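(* Let $t$ and $\lambda$ be positive integers with $t \ge \lambda+1$ and $t \ge 3$. Then the complete digraph $\overleftrightarrow{K}_{t+\lambda}$ on $t+\lambda$ vertices is the only $(t,\lambda)$-liking digraph; that is, every $(t,\lambda)$-liking digraph is isomorphic to $\overleftrightarrow{K}_{t+\lambda}$.
   Context: All digraphs are finite, with no loops and no multiple arcs. For positive integers $t$ and $\lambda$, a digraph is a $(t,\lambda)$-liking digraph if every set of $t$ distinct vertices has exactly $\lambda$ common out-neighbors. The complete digraph $\overleftrightarrow{K}_m$ is the digraph on $m$ vertices in which, for every pair $x,y$ of distinct vertices, both arcs $(x,y)$ and $(y,x)$ are present.
   Formalization: The digraph is additionally required to have at least t vertices, since a digraph with fewer than t vertices (e.g. a single vertex) satisfies the (t,λ)-liking condition vacuously and is not isomorphic to the complete digraph on t+λ vertices. *)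

(* Defs.v *)
From mathcomp Require Import all_boot.

Set Implicit Arguments.
Unset Strict Implicit.
Unset Printing Implicit Defensive.

Record digraph := Digraph {
  vertex : finType;
  has_arc : rel vertex;
  has_arc_irrefl : irreflexive has_arc
}.

Definition out_nbrs (D : digraph) (u : vertex D) : {set vertex D} :=
  [set v | has_arc u v].

Definition common_out_nbrs (D : digraph) (S : {set vertex D}) :
  {set vertex D} := \bigcap_(u in S) out_nbrs u.

(* Vacuously true when D has fewer than t vertices. *)
Definition liking (t lambda : nat) (D : digraph) : Prop :=
  forall S : {set vertex D}, #|S| = t -> #|common_out_nbrs S| = lambda.

Lemma complete_arc_irrefl (m : nat) :
  irreflexive (fun x y : 'I_m => x != y).
Proof. by move=> x; rewrite /= eqxx. Qed.

Definition complete_digraph (m : nat) : digraph :=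
  Digraph (@complete_arc_irrefl m).

Definition digraph_iso (D E : digraph) : Prop :=
  exists2 f : vertex D -> vertex E,
    bijective f & forall x y : vertex D, has_arc (f x) (f y) = has_arc x y.

(* Main.v *)
Require Import Defs.
From mathcomp Require Import all_boot.
From mathcomp Require Import all_order all_algebra.

(** Fix a set [S] of [t - 2 >= 1] vertices. The in-neighborhoods of the common
    out-neighbors of [S], traced on the complement of [S], form a pairwise
    balanced design of index [lambda]. No such block contains its own vertex,
    so no block is everything and every point lies in more than [lambda]
    blocks; Fisher's inequality then gives at least as many blocks as points.
    Hence every vertex outside [S] is a common out-neighbor of [S], and letting
    [S] vary shows that all arcs are present. *)

Section Fisher.
Import GRing.Theory Num.Theory.
Local Open Scope ring_scope.

(** The rational incidence matrix has independent rows, so its rank [#|P|] is at most its number of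
    columns. Blocks are indexed by [B], so repeated blocks are allowed. *)
Lemma fisher_inequality (T U : finType) (inc : T -> U -> bool)
    (P : {set T}) (B : {set U}) (lambda : nat) :
  {in P &, forall x y, x != y ->
     #|[set b in B | inc x b && inc y b]| = lambda} ->
  {in P, forall x, lambda < #|[set b in B | inc x b]|}%N ->
  (#|P| <= #|B|)%N.
Proof.
move=> pairs reps.
pose M : 'M[rat]_(#|P|, #|B|) :=
  \matrix_(i, j) (inc (enum_val i) (enum_val j))%:R.
pose r (i : 'I_#|P|) := #|[set b in B | inc (enum_val i) b]|.
(* The Gram matrix [M M^T] is [lambda J] plus a positive diagonal matrix. *)
have gramE i k : (M *m M^T) i k =
    lambda%:R + (i == k)%:R * (r i - lambda)%N%:R.
  have -> : (M *m M^T) i k =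
      #|[set b in B | inc (enum_val i) b && inc (enum_val k) b]|%:R.
    rewrite mxE -[#|[set _ in _ | _]|]sum1_card natr_sum.
    rewrite (eq_bigl (fun b => (b \in B) &&
      (inc (enum_val i) b && inc (enum_val k) b))); last first.
      by move=> b; rewrite inE.
    rewrite big_mkcondr /= [RHS]big_enum_val; apply: eq_bigr => j _.
    by rewrite !mxE; do 2![case: (inc _ _)]; rewrite ?mulr1 ?mulr0.
  have [<-|neq_ik] := eqVneq i k.
    under eq_finset => b do rewrite andbb.
    by rewrite mul1r -natrD subnKC // ltnW // reps // enum_valP.
  rewrite mul0r addr0 pairs ?enum_valP //.
  by apply: contraNneq neq_ik => /enum_val_inj ->.
suff /eqP <- : row_free M by exact: rank_leq_col.
apply/inj_row_free => u uM0.
have : (u *m (M *m M^T) *m u^T) 0 0 = 0 by rewrite mulmxA uM0 !mul0mx mxE.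
(* The quadratic form splits into two nonnegative terms, so both vanish; since each [r i - lambda]
   is positive, every [u 0 i] is zero. *)
have -> : (u *m (M *m M^T) *m u^T) 0 0 =
    lambda%:R * (\sum_i u 0 i) ^+ 2
    + \sum_i (r i - lambda)%N%:R * u 0 i ^+ 2.
  rewrite mxE expr2 mulr_sumr mulr_sumr -big_split /=.
  apply: eq_bigr => k _; rewrite !mxE.
  have -> : \sum_i u 0 i * (M *m M^T) i k =
      lambda%:R * (\sum_i u 0 i) + (r k - lambda)%N%:R * u 0 k.
    under eq_bigr => i _ do rewrite gramE mulrDr.
    rewrite big_split /= -mulr_suml [X in X + _]mulrC; congr (_ + _).
    rewrite (bigD1 k) //= eqxx mul1r big1 ?addr0 1?mulrC // => i /negPf ->.
    by rewrite mul0r mulr0.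
  by rewrite mulrDl expr2 !mulrA.
have sum_ge0 i : true -> 0 <= (r i - lambda)%N%:R * u 0 i ^+ 2.
  by move=> _; exact: mulr_ge0 (ler0n _ _) (sqr_ge0 _).
have sq_ge0 : 0 <= lambda%:R * (\sum_i u 0 i) ^+ 2.
  exact: mulr_ge0 (ler0n _ _) (sqr_ge0 _).
move/eqP; rewrite (paddr_eq0 sq_ge0 (sumr_ge0 _ sum_ge0)).
case/andP=> _; rewrite psumr_eq0 // => /allP u0.
apply/rowP=> i; rewrite mxE; apply/eqP.
have := u0 i (mem_index_enum i); rewrite /= mulf_eq0 pnatr_eq0 sqrf_eq0.
by rewrite subn_eq0 leqNgt reps ?enum_valP.
Qed.

End Fisher.

Lemma exists_subset_card (T : finType) (A : {set T}) (k : nat) :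
  k <= #|A| -> exists2 B : {set T}, B \subset A & #|B| = k.
Proof.
move=> le_kA; exists [set x in take k (enum A)].
  by apply/subsetP=> x; rewrite inE => /mem_take; rewrite mem_enum.
rewrite cardsE (card_uniqP _) ?take_uniq ?enum_uniq //.
by rewrite size_takel // -cardE.
Qed.

Section CommonOutNeighbors.
Variable D : digraph.
Implicit Types (x y v : vertex D) (S : {set vertex D}).

Lemma common_out_nbrsP S v :
  reflect {in S, forall u, has_arc u v} (v \in common_out_nbrs S).
Proof.
by apply: (iffP bigcapP) => arcs u /arcs; rewrite inE.
Qed.

(** Adding [x] to [S] selects the blocks through the point [x]; this translates liking into block
    counts. *)
Lemma common_out_nbrsU1 x S :
  common_out_nbrs (x |: S) = [set v in common_out_nbrs S | has_arc x v].
Proof.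
by apply/setP=> v; rewrite /common_out_nbrs bigcap_setU big_set1 !inE andbC.
Qed.

Lemma common_out_nbrs_subC S : common_out_nbrs S \subset ~: S.
Proof.
apply/subsetP=> v /common_out_nbrsP arcs; rewrite inE.
by apply/negP=> /arcs; rewrite has_arc_irrefl.
Qed.

Lemma common_out_nbrs_complete S :
  (forall x y, x != y -> has_arc x y) -> common_out_nbrs S = ~: S.
Proof.
move=> full; apply/eqP; rewrite eqEsubset common_out_nbrs_subC.
apply/subsetP=> v; rewrite inE => vNS; apply/common_out_nbrsP=> u uS.
by apply: full; apply: contraNneq vNS => <-.
Qed.

Section Liking.
Variables t lambda : nat.
Hypotheses (lambda_gt0 : 0 < lambda) (le_t_card : t <= #|vertex D|).
Hypothesis likingD : liking t lambda D.

(** A common out-neighbor [v] of [S] lies outside [S]. Adding it to [S] leaves exactly [lambda]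
    common out-neighbors and loses [v] itself, as there are no loops. *)
Lemma liking_lt_card_common_out_nbrs S :
  #|S|.+1 = t -> lambda < #|common_out_nbrs S|.
Proof.
move=> cardS.
have card_add y : y \notin S -> #|common_out_nbrs (y |: S)| = lambda.
  by move=> yNS; apply: likingD; rewrite cardsU1 yNS add1n.
have sub_add y : common_out_nbrs (y |: S) \subset common_out_nbrs S.
  by rewrite common_out_nbrsU1; apply/subsetP=> v; rewrite inE => /andP[].
(* The vertex [y] only serves to show that [S] has some common out-neighbor, via [0 < lambda]. *)
have [y yNS] : exists y, y \in ~: S.
  by apply/card_gt0P; rewrite cardsCs setCK subn_gt0 cardS.
rewrite inE in yNS; have le_y := subset_leq_card (sub_add y).
rewrite card_add // in le_y.
have [v vN] := card_gt0P (leq_trans lambda_gt0 le_y).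
have vNS : v \notin S.
  by have /subsetP/(_ v vN) := common_out_nbrs_subC S; rewrite inE.
rewrite -(card_add v vNS); apply: proper_card; apply/properP; split=> //.
by exists v => //; rewrite common_out_nbrsU1 inE has_arc_irrefl andbF.
Qed.

Lemma liking_common_out_nbrs S : #|S|.+2 = t -> common_out_nbrs S = ~: S.
Proof.
move=> cardS; apply/eqP; rewrite eqEcard common_out_nbrs_subC /=.
(* Points are the vertices of [~: S], and blocks are indexed by [common_out_nbrs S]. Two points
   extend [S] to a [t]-set, one point to a [(t-1)]-set. *)
apply: (fisher_inequality _ _ (@has_arc D) _ _ lambda) => [x y|x].
  rewrite !inE => xNS yNS neq_xy.
  have <- : #|common_out_nbrs (y |: (x |: S))| = lambda.
    apply: likingD; rewrite !cardsU1 !inE negb_or eq_sym neq_xy xNS yNS.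
    by rewrite !add1n.
  by apply: eq_card => v; rewrite !common_out_nbrsU1 !inE andbA.
rewrite inE => xNS; rewrite -common_out_nbrsU1.
by apply: liking_lt_card_common_out_nbrs; rewrite cardsU1 xNS add1n.
Qed.

Lemma liking_complete x y : 2 < t -> x != y -> has_arc x y.
Proof.
move=> t_gt2 neq_xy.
(* Size [t - 3] makes [x |: S] a [(t-2)]-set avoiding [y], so [y] is one of its common
   out-neighbors. *)
have [S subS cardS] : 
    exists2 S : {set vertex D}, S \subset ~: [set x; y] & #|S| = t - 3.
  by apply: exists_subset_card; rewrite cardsCs setCK cards2 neq_xy leq_sub.
have [xNS yNS] : x \notin S /\ y \notin S.
  by split; apply/negP=> /(subsetP subS); rewrite !inE eqxx ?orbT.
have cardxS : #|x |: S|.+2 = t.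
  by rewrite cardsU1 xNS cardS -addn2 addnC addnA subnKC.
have /common_out_nbrsP/(_ x) : y \in common_out_nbrs (x |: S).
  by rewrite liking_common_out_nbrs // !inE negb_or eq_sym neq_xy.
by apply; rewrite setU11.
Qed.

(** With all arcs present, the [lambda] common out-neighbors of a [t]-set are exactly its
    complement. *)
Lemma liking_card : 2 < t -> #|vertex D| = t + lambda.
Proof.
move=> t_gt2.
have [S _ cardS] : exists2 S : {set vertex D}, S \subset setT & #|S| = t.
  by apply: exists_subset_card; rewrite cardsT.
have := likingD _ cardS; rewrite common_out_nbrs_complete => [<-|x y].
  by rewrite -cardS cardsC.
exact: liking_complete.
Qed.

End Liking.
End CommonOutNeighbors.

Lemma complete_digraph_iso (D : digraph) (m : nat) :
  #|vertex D| = m -> (forall x y : vertex D, x != y -> has_arc x y) ->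
  digraph_iso D (complete_digraph m).
Proof.
move=> <- full; exists (@enum_rank (vertex D)); first exact: enum_rank_bij.
move=> x y; rewrite /= (inj_eq enum_rank_inj).
have [<-|/full ->//] := eqVneq x y.
by rewrite has_arc_irrefl.
Qed.

(** The bound [t <= #|vertex D|] excludes the digraphs that satisfy [liking] vacuously. *)
Theorem theorem4p3 (t lambda : nat) (t_gt0 : 0 < t) (lambda_gt0 : 0 < lambda)
    (le_lambda_t : lambda + 1 <= t) (t_ge3 : 3 <= t) :
  liking t lambda (complete_digraph (t + lambda)) /\
  (forall D : digraph, t <= #|vertex D| -> liking t lambda D ->
     digraph_iso D (complete_digraph (t + lambda))).
Proof.
split=> [S cardS|D le_t_card likingD].
  by rewrite common_out_nbrs_complete // cardsCs setCK cardS card_ord addKn.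
apply: complete_digraph_iso; first exact: liking_card.
by move=> x y; apply: (liking_complete D t lambda).
Qed.
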